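(* Let $k$ be a field. Assume that $(R,\mathfrak{m}_R)$ is a noetherian local $k$-algebra (not necessarily complete). Let $n$ be a positive integer, $x$ be an element in $\mathfrak{m}_R$ such that $(0:x)=x^nR\neq(0)$, and $\overline{R}=R/xR$. Then the following are equivalent: (i) The $\overline{R}$-module $k$ is liftable to $R$. (ii) Considering the $k$-subalgebra $(k[x],(x))$ of $(R,\mathfrak{m}_R)$, the inclusion $k[x]\subseteq R$ has a retraction. (iii) There is a $k$-subalgebra $(S,\mathfrak{m}_S)$ of $(R,\mathfrak{m}_R)$ such that $R$ admits a semi-fiber product decomposition $R\cong k[x]\ltimes_k S$. More precisely, under these equivalent conditions, $S=k\oplus\mathfrak{m}_S$, where $\mathfrak{m}_S$ is the kernel of the retraction of the inclusion $k[x]\subseteq R$.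
   Context: All rings are commutative with unity. A ''$k$-algebra'' $(R,\mathfrak{m}_R)$ means a (not necessarily local or noetherian) $k$-algebra $R$ with a specified maximal ideal $\mathfrak{m}_R$ such that the composition $k\hookrightarrow R\twoheadrightarrow R/\mathfrak{m}_R$ is an isomorphism; thus $R=k\oplus\mathfrak{m}_R$ as $k$-vector spaces. A $k$-algebra homomorphism $f\colon(R,\mathfrak{m}_R)\to(S,\mathfrak{m}_S)$ is always assumed to satisfy $f(\mathfrak{m}_R)\subseteq\mathfrak{m}_S$. $(0:x)=\{r\in R\mid rx=0\}$, and $k[x]$ is the $k$-subalgebra of $R$ generated by the element $x$. Liftability: a complex $F$ of free $\overline{R}$-modules is liftable to $R$ (along the natural surjection $R\to\overline{R}$) if there is a complex $L$ of free $R$-modules with $L\otimes_R\overline{R}\cong F$ as $\overline{R}$-complexes. An $\overline{R}$-module $M$ is liftable to $R$ if there is an $\overline{R}$-free resolution of $M$ that is liftable to $R$. Here $k$ is the residue field of $\overline R$ as an $\overline R$-module. Retraction: if $f\colon R\to S$ and $g\colon S\to R$ are $k$-algebra homomorphisms with $f$ injective, $g$ surjective and $g\circ f=\mathrm{id}_R$, then $g$ is called a retraction of $f$. Semi-fiber product: let $(T,\mathfrak{m}_T)$ and $(S,\mathfrak{m}_S)$ be $k$-algebras with a $T$-action $\ast$ on $\mathfrak{m}_S$ under which $\mathfrak{m}_S$ becomes a $(T,S)$-bimodule (so $\ell\ast y=\ell y$ for $\ell\in k$, and $t\ast(ys)=(t\ast y)s$ for $t\in T$, $y\in\mathfrak{m}_S$,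 $s\in S$). The semi-fiber product $T\ltimes_k S$ is the $k$-vector space $k\oplus\mathfrak{m}_T\oplus\mathfrak{m}_S=T\oplus\mathfrak{m}_S$ with multiplication $(t\oplus y)\cdot(t'\oplus y')=tt'\oplus(t\ast y'+t'\ast y+yy')$; it is a $k$-algebra with specified maximal ideal $\mathfrak{m}_T\oplus\mathfrak{m}_S$. A $k$-algebra $(A,\mathfrak{m}_A)$ admits a semi-fiber product decomposition if there exist $k$-subalgebras $(T,\mathfrak{m}_T)$ and $(S,\mathfrak{m}_S)$ of $A$ such that an isomorphism $A\cong T\ltimes_k S$ of $k$-algebras holds.
   Formalization: In (iii) the isomorphism k[x] ⋉_k S ≅ R is required to be the one induced by the inclusions, (t, y) ↦ t + y; with an arbitrary isomorphism (iii) ⇒ (ii) fails, e.g. for R = k[u,y]/(u⁴,y²), x = u², n = 1. *)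

(* Defs.v *)
From HB Require Import structures.
From mathcomp Require Import all_boot all_order all_algebra ring.
From mathcomp Require Import boolp.

Set Implicit Arguments.
Unset Strict Implicit.
Unset Printing Implicit Defensive.

Import GRing.Theory.
Local Open Scope ring_scope.
Local Open Scope quotient_scope.

(* Subsets are boolean predicates [{pred R}]; classically every [Prop]-valued
   predicate is one of these, through [`[< _ >]]. *)

Section Rings.
Variable A : comNzRingType.

(* [idealr_closed] includes properness. *)
Definition maximal_ideal (m : {pred A}) : Prop :=
  idealr_closed m /\
  forall J : {pred A}, idealr_closed J -> {subset m <= J} -> {subset J <= m}.

(* The ideals of [A], not necessarily proper, are the submodules of [A^o]. *)
Definition noetherian : Prop :=
  forall J : {pred A^o}, submod_closed J ->
    exists (N : nat) (a : 'I_N -> A),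
      forall r : A, r \in J <-> exists c : 'I_N -> A, r = \sum_(i < N) c i * a i.

Definition annihilator (x : A) : {pred A} := [pred r | r * x == 0].

Definition principal (x : A) : {pred A} :=
  fun r => `[< exists a : A, r = x * a >].

End Rings.

Section Pointed.
Variable k : fieldType.

(* [m] is a maximal ideal and k -> A -> A/m is bijective. *)
Definition pointed_by (A : comAlgType k) (m : {pred A}) : Prop :=
  maximal_ideal m /\ forall r : A, exists! c : k, r - c%:A \in m.

Record kalg := KAlg {
  kalg_sort :> comAlgType k;
  kmax : {pred kalg_sort};
  kalgP : pointed_by kmax }.
Arguments kmax : clear implicits.

Record khom (A B : kalg) := KHom {
  khom_fun :> {lrmorphism A -> B};
  khomP : forall a : A, a \in kmax A -> khom_fun a \in kmax B }.

Definition local_kalg (A : kalg) : Prop :=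
  forall J : {pred A}, maximal_ideal J -> J =i kmax A.

Definition is_retraction (A B : kalg) (f : khom A B) (g : khom B A) : Prop :=
  [/\ injective f, (forall a : A, exists b : B, g b = a) & cancel f g].

Lemma kmax_ideal (A : kalg) : idealr_closed (kmax A).
Proof. by case: (kalgP A) => -[]. Qed.

Lemma pointed_byI (A : comAlgType k) (m : {pred A}) :
  idealr_closed m -> (forall r : A, exists c : k, r - c%:A \in m) ->
  pointed_by m.
Proof.
move=> mI m_res; have [m0 m1 mD] := mI.
have mM a u : u \in m -> a * u \in m by move=> mu; rewrite -[_ * _]addr0 mD.
have mA c : c%:A \in m -> c = 0.
  move=> mc; apply/eqP/negP => /negP c0; case/negP: m1.
  have -> : 1 = c^-1%:A * c%:A :> A by rewrite mulr_algl scalerA mulVf ?scale1r.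
  exact: mM.
split; first split=> // J [J0 J1 JD] mJ r Jr.
  have [c mc] := m_res r; suff c0 : c = 0 by move: mc; rewrite c0 scale0r subr0.
  apply/eqP/negP => /negP c0; case/negP: J1.
  have -> : 1 = (- c^-1%:A) * (r - c%:A) + (c^-1%:A * r + 0) :> A.
    by rewrite addr0 mulNr mulrBr opprB subrK mulr_algl scalerA mulVf ?scale1r.
  by apply: (JD); [exact: mJ | exact: JD].
move=> r; have [c mc] := m_res r; exists c; split=> // d md.
apply/eqP; rewrite -subr_eq0; apply/eqP/mA.
have -> : (c - d)%:A = (-1) * (r - c%:A) + (r - d%:A) :> A.
  by rewrite mulN1r opprB scalerBl addrA subrK.
exact: mD.
Qed.

(* The image of [r] under A -> A/m = k. *)
Definition residue (A : kalg) (r : A) : k :=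
  sval (cid ((kalgP A).2 r)).

Section Residue.
Variable A : kalg.

Lemma residue_max (r : A) : r - (residue r)%:A \in kmax A.
Proof. by rewrite /residue; case: cid => c []. Qed.

Lemma residueP (r : A) (c : k) : r - c%:A \in kmax A -> residue r = c.
Proof. by rewrite /residue; case: cid => d /= [_ dP] /dP. Qed.

Lemma residue_zmod : zmod_morphism (@residue A).
Proof.
move=> r s; apply: residueP; have [m0 _ mD] := kmax_ideal A.
rewrite (_ : _ - _ = -1 * (s - (residue s)%:A) + (r - (residue r)%:A)).
  by apply: mD; exact: residue_max.
rewrite scalerBl; move: (residue r)%:A (residue s)%:A => a b; ring.
Qed.

Lemma residue_monoid : monoid_morphism (@residue A).
Proof.
have [m0 _ mD] := kmax_ideal A; split=> [|r s]; apply: residueP.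
  by rewrite scale1r subrr.
have h : residue r *: (s - (residue s)%:A) + 0 \in kmax A.
  by rewrite -(mulr_algl (residue r)); apply: mD => //; exact: residue_max.
have := mD s _ _ (residue_max r) h.
by rewrite addr0 mulrBr scalerBr scalerA mulr_algr addrA subrK mulrC.
Qed.
End Residue.

Section Subalgebra.
Variables (A : comAlgType k) (S : subalgClosed A).

Lemma subalg_subring : subring_closed (fun a : A => a \in S).
Proof.
have [S1 Slin SM] := GRing.subalgClosedP S.
by split=> // u v Su Sv; rewrite addrC -scaleN1r; exact: Slin.
Qed.

Record subalg := Subalg { subalg_val : A; _ : subalg_val \in S }.
HB.instance Definition _ := [isSub for subalg_val].
HB.instance Definition _ := [Choice of subalg by <:].
HB.instance Definition _ :=
  GRing.SubChoice_isSubComNzRing.Build A _ subalg subalg_subring.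
HB.instance Definition _ :=
  GRing.SubZmodule_isSubLmodule.Build k A _ subalg
    (GRing.submod_closed_semi (GRing.subalg_closedZ (GRing.subalgClosedP S))).
HB.instance Definition _ :=
  GRing.SubNzRing_SubLmodule_isSubLalgebra.Build k A _ subalg.
HB.instance Definition _ :=
  GRing.SubLalgebra_isSubAlgebra.Build k A _ subalg.

(* The join of the linear and multiplicative structures of [val] is not
   inferred. *)
HB.instance Definition _ :=
  GRing.Linear.copy subalg_val (val : subalg -> A).
HB.instance Definition _ :=
  GRing.RMorphism.copy subalg_val (val : subalg -> A).
End Subalgebra.

Record ksubalg (A : kalg) := KSubalg {
  ksub_set : subalgClosed A;
  ksub_max : {pred subalg ksub_set};
  ksub_pointed : pointed_by ksub_max;
  ksub_maxP : forall s : subalg ksub_set,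
    s \in ksub_max -> subalg_val s \in kmax A }.

Definition ksub_kalg (A : kalg) (S : ksubalg A) : kalg :=
  KAlg (ksub_pointed S).
Coercion ksub_kalg : ksubalg >-> kalg.

Definition kincl (A : kalg) (S : ksubalg A) : khom S A :=
  @KHom S A (@subalg_val A (ksub_set S)) (@ksub_maxP A S).

Section Generated.
Variables (A : comAlgType k) (x : A).

Definition gen_subalg : {pred A} :=
  fun r => `[< forall S : {pred A}, subalg_closed S -> x \in S -> r \in S >].

Lemma gen_subalg_closed : subalg_closed gen_subalg.
Proof.
split=> [|c u v /asboolP Gu /asboolP Gv|u v /asboolP Gu /asboolP Gv];
  apply/asboolP => S [S1 Slin SM] Sx; rewrite // ?Slin ?SM //;
  by [exact: Gu | exact: Gv].
Qed.

HB.instance Definition _ := GRing.isSubalgClosed.Build k A gen_subalg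
  (GRing.subalg_closed_semi gen_subalg_closed).

Lemma gen_subalg_mem : x \in gen_subalg.
Proof. by apply/asboolP. Qed.

Definition gen_elt : subalg gen_subalg := Subalg gen_subalg_mem.

Lemma gen_subalgE (r : subalg gen_subalg) :
  exists (c : k) (s : subalg gen_subalg), r = c%:A + gen_elt * s.
Proof.
pose P : {pred A} := fun u =>
  `[< exists (c : k) (s : subalg gen_subalg), u = c%:A + x * subalg_val s >].
have PP : subalg_closed P.
  split=> [|a u v /asboolP[c [s ->]] /asboolP[d [t ->]]
           |u v /asboolP[c [s ->]] /asboolP[d [t ->]]]; apply/asboolP.
  - by exists 1, 0; rewrite scale1r mulr0 addr0.
  - exists (a * c + d), (a *: s + t).
    have -> : subalg_val (a *: s + t) = a *: subalg_val s + subalg_val t by [].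
    by rewrite scalerDr scalerDl mulrDr -scalerA -scalerAr addrACA.
  - exists (c * d), (c *: t + d *: s + gen_elt * s * t).
    have -> : subalg_val (c *: t + d *: s + gen_elt * s * t)
            = c *: subalg_val t + d *: subalg_val s + x * subalg_val s * subalg_val t by [].
    rewrite mulrDl !mulrDr !mulr_algl mulr_algr -!scalerAr -!scalerA -!addrA.
    by congr (_ + (_ + (_ + _))); rewrite -!mulrA (mulrCA (subalg_val s)).
have Px : x \in P.
  by apply/asboolP; exists 0, 1; rewrite scale0r add0r mulr1.
have /asboolP[c [s Er]] : subalg_val r \in P.
  by have /asboolP := valP r; apply.
by exists c, s; apply: val_inj; exact: Er.
Qed.
End Generated.

Section Generated_pointed.
Variables (A : kalg) (x : A).
Hypothesis mx : x \in kmax A.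

(* The ideal (x) of k[x]. *)
Definition gen_max : {pred subalg (gen_subalg x)} := principal (gen_elt x).

Lemma gen_max_sub (s : subalg (gen_subalg x)) :
  s \in gen_max -> subalg_val s \in kmax A.
Proof.
case/asboolP=> t ->; have -> : subalg_val (gen_elt x * t) = subalg_val t * x + 0.
  by rewrite addr0 mulrC.
by have [m0 _ mD] := kmax_ideal A; apply: mD.
Qed.

Lemma gen_pointed : pointed_by gen_max.
Proof.
apply: pointed_byI => [|r]; last first.
  have [c [s Er]] := gen_subalgE r; exists c; apply/asboolP; exists s.
  by rewrite Er addrC addKr.
split=> [||a u v /asboolP[s ->] /asboolP[t ->]].
- by apply/asboolP; exists 0; rewrite mulr0.
- by apply/negP => /gen_max_sub; have [_ /negP] := kmax_ideal A.
- by apply/asboolP; exists (a * s + t); rewrite mulrDr mulrCA.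
Qed.

Definition gen_ksubalg : ksubalg A := KSubalg gen_pointed gen_max_sub.
End Generated_pointed.

Section MaxIdeal.
Variable A : kalg.

Lemma kmax_submod : submod_closed (fun a : A => a \in kmax A).
Proof.
have [m0 _ mD] := kmax_ideal A; split=> // c u v mu mv.
by have := mD c%:A u v mu mv; rewrite mulr_algl.
Qed.

Record kmaxT := KmaxT { kmaxT_val : A; _ : kmaxT_val \in kmax A }.
HB.instance Definition _ := [isSub for kmaxT_val].
HB.instance Definition _ := [Choice of kmaxT by <:].
HB.instance Definition _ := GRing.SubChoice_isSubLmodule.Build k A _ kmaxT
  (GRing.submod_closed_semi kmax_submod).

Lemma kmaxT_inj : injective kmaxT_val.
Proof. exact: val_inj. Qed.

Lemma kmaxT_valD (y z : kmaxT) :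
  kmaxT_val (y + z) = kmaxT_val y + kmaxT_val z.
Proof. by []. Qed.

Lemma kmaxT_mul_subproof (y : kmaxT) (a : A) : kmaxT_val y * a \in kmax A.
Proof.
have [m0 _ mD] := kmax_ideal A; rewrite mulrC -[_ * _]addr0.
by apply: mD => //; exact: valP.
Qed.

Definition kmaxT_mul (y : kmaxT) (a : A) : kmaxT :=
  KmaxT (kmaxT_mul_subproof y a).
End MaxIdeal.

Record kaction (T S : kalg) := KAction {
  kact :> T -> kmaxT S -> kmaxT S;
  kactDl : forall y, {morph kact^~ y : t t' / t + t'};
  kactDr : forall t, {morph kact t : y y' / y + y'};
  kactM : forall t t' y, kact (t * t') y = kact t (kact t' y);
  kact_scalar : forall (l : k) y, kact l%:A y = l *: y;
  kact_mul : forall t y s, kact t (kmaxT_mul y s) = kmaxT_mul (kact t y) s }.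

Section SemiFiber.
Variables (T S : kalg) (act : kaction T S).

Definition semifiber : Type := (T * kmaxT S)%type.
HB.instance Definition _ := GRing.Lmodule.on semifiber.

Definition semifiber_one : semifiber := (1, 0).
Definition semifiber_mul (p q : semifiber) : semifiber :=
  (p.1 * q.1, act p.1 q.2 + act q.1 p.2 + kmaxT_mul p.2 (kmaxT_val q.2)).

Lemma kact1 y : act 1 y = y.
Proof. by rewrite -[RHS]scale1r -(kact_scalar act) scale1r. Qed.

Lemma kact0r t : act t 0 = 0.
Proof. by apply: (addrI (act t 0)); rewrite -kactDr !addr0. Qed.

Lemma kactZl c t y : act (c *: t) y = c *: act t y.
Proof. by rewrite -mulr_algl kactM kact_scalar. Qed.

Lemma kactZr c t y : act t (c *: y) = c *: act t y.
Proof. by rewrite -!(kact_scalar act) -!kactM mulrC. Qed.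

Lemma val_kact_mul t y s : kmaxT_val (act t (kmaxT_mul y s)) = kmaxT_val (act t y) * s.
Proof. by rewrite kact_mul. Qed.

Lemma kact_swap t y z : kmaxT_val (act t y) * kmaxT_val z = kmaxT_val y * kmaxT_val (act t z).
Proof.
rewrite -val_kact_mul (_ : kmaxT_mul y (kmaxT_val z) = kmaxT_mul z (kmaxT_val y)).
  by rewrite val_kact_mul mulrC.
by apply: kmaxT_inj; rewrite /= mulrC.
Qed.

Lemma kactC t u y : act t (act u y) = act u (act t y).
Proof. by rewrite -!kactM mulrC. Qed.

Lemma semifiber_mulC : commutative semifiber_mul.
Proof.
move=> p q; congr pair; first by rewrite mulrC.
by rewrite [act q.1 _ + _]addrC; congr (_ + _); apply: kmaxT_inj; rewrite /= mulrC.
Qed.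

Lemma semifiber_mulA : associative semifiber_mul.
Proof.
move=> [t y] [t' y'] [u z]; congr pair; rewrite /= ?mulrA //.
apply: kmaxT_inj; rewrite !(kactDr, kactM, kmaxT_valD) /= ?kmaxT_valD !val_kact_mul.
rewrite !mulrDr !mulrDl -!kact_swap (kactC t' u) (kactC t u); ring.
Qed.

Lemma semifiber_mul1 : left_id semifiber_one semifiber_mul.
Proof.
move=> [t y]; rewrite /semifiber_mul /= mul1r kact1 kact0r addr0.
by congr pair; apply: kmaxT_inj; rewrite /= mul0r addr0.
Qed.

Lemma semifiber_mulD : left_distributive semifiber_mul +%R.
Proof.
move=> [t y] [t' y'] [u z]; congr pair; rewrite /= ?mulrDl //.
apply: kmaxT_inj; rewrite !(kactDl, kactDr, kmaxT_valD) /= ?kmaxT_valD ?mulrDl.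
by ring.
Qed.

Lemma semifiber_1neq0 : semifiber_one != 0.
Proof. by apply/eqP => -[/eqP]; rewrite oner_eq0. Qed.

HB.instance Definition _ := GRing.Zmodule_isComNzRing.Build semifiber
  semifiber_mulA semifiber_mulC semifiber_mul1 semifiber_mulD semifiber_1neq0.

Lemma semifiber_scaleAl (c : k) (p q : semifiber) : c *: (p * q) = c *: p * q.
Proof.
congr pair; rewrite /= ?scalerAl // kactZl kactZr !scalerDr; congr (_ + _).
by apply: kmaxT_inj; rewrite /= -scalerAl.
Qed.

HB.instance Definition _ :=
  GRing.Lmodule_isLalgebra.Build k semifiber semifiber_scaleAl.
HB.instance Definition _ := GRing.Lalgebra_isComAlgebra.Build k semifiber.

Definition semifiber_max : {pred semifiber} := [pred p | p.1 \in kmax T].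

Lemma semifiber_pointed : pointed_by semifiber_max.
Proof.
have [m0 m1 mD] := kmax_ideal T; apply: pointed_byI => [|p]; last first.
  by have [_ /(_ p.1)[c [mc _]]] := kalgP T; exists c.
by split=> // a u v; exact: mD.
Qed.

Definition semifiber_kalg : kalg := KAlg semifiber_pointed.
End SemiFiber.

(* The isomorphism is required to be induced by the inclusions of [T] and [S]
   in [A]: an abstract one would only see the isomorphism classes of [T] and
   [S], not how they sit in [A].  Then [act] is forced to be the product
   of [A]. *)
Definition semifiber_decomposition (A : kalg) (T S : ksubalg A) : Prop :=
  exists (act : kaction T S) (phi : khom (semifiber_kalg act) A),
    bijective phi /\
    forall (t : T) (y : kmaxT S), phi (t, y) = kincl T t + kincl S (kmaxT_val y).

Section Quotient.
Variables (A : kalg) (x : A).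
Hypothesis mx : x \in kmax A.

Definition xideal of x \in kmax A : {pred A} := principal x.

Lemma xideal_sub (r : A) : r \in xideal mx -> r \in kmax A.
Proof.
case/asboolP=> a ->; have [m0 _ mD] := kmax_ideal A.
by rewrite mulrC -[_ * _]addr0 mD.
Qed.

Lemma xideal_closed : idealr_closed (xideal mx).
Proof.
split=> [||a u v /asboolP[s ->] /asboolP[t ->]].
- by apply/asboolP; exists 0; rewrite mulr0.
- by apply/negP => /xideal_sub; have [_ /negP] := kmax_ideal A.
- by apply/asboolP; exists (a * s + t); rewrite mulrDr mulrCA.
Qed.

HB.instance Definition _ := isIdealr.Build A (xideal mx) xideal_closed.

Definition quot_x : comNzRingType := {ideal_quot (xideal mx)}.

Definition quot_map : {rmorphism A -> quot_x} := \pi_{ideal_quot (xideal mx)}.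

(* The map A/xA -> A/m = k. *)
Definition quot_residue (r : quot_x) : k := residue (repr r).

Lemma quot_residueE (r : A) : quot_residue (quot_map r) = residue r.
Proof.
apply/esym/residueP; have [m0 _ mD] := kmax_ideal A.
have rx : r - repr (quot_map r) \in kmax A.
  by apply: xideal_sub; rewrite Quotient.idealrBE reprK.
have := mD 1 _ _ rx (residue_max (repr (quot_map r))).
by rewrite mul1r addrA subrK.
Qed.

Lemma quot_residue_zmod : zmod_morphism quot_residue.
Proof.
move=> r s; rewrite -[r]reprK -[s]reprK.
rewrite -[X in quot_residue X](rmorphB quot_map) !quot_residueE.
exact: residue_zmod.
Qed.

Lemma quot_residue_monoid : monoid_morphism quot_residue.
Proof.
split=> [|r s].
  rewrite -[1](rmorph1 quot_map) quot_residueE; exact: (residue_monoid A).1.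
rewrite -[r]reprK -[s]reprK.
rewrite -[X in quot_residue X](rmorphM quot_map) !quot_residueE.
exact: (residue_monoid A).2.
Qed.

HB.instance Definition _ :=
  GRing.isZmodMorphism.Build quot_x k quot_residue quot_residue_zmod.
HB.instance Definition _ :=
  GRing.isMonoidMorphism.Build quot_x k quot_residue quot_residue_monoid.

End Quotient.
End Pointed.

Arguments kmax {k} A : rename.
Arguments quot_residue {k A x} mx r.

Definition restrict_scalars (A B : comNzRingType) (f : {rmorphism A -> B})
  (M : lmodType B) : Type := M.

Section RestrictScalars.
Variables (A B : comNzRingType) (f : {rmorphism A -> B}) (M : lmodType B).
Local Notation restrict := (restrict_scalars f M).

HB.instance Definition _ := GRing.Zmodule.on restrict.

Definition restr_scale (a : A) (v : restrict) : restrict := f a *: (v : M).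

Lemma restr_scaleA a b v :
  restr_scale a (restr_scale b v) = restr_scale (a * b) v.
Proof. by rewrite /restr_scale rmorphM scalerA. Qed.
Lemma restr_scale1 : left_id 1 restr_scale.
Proof. by move=> v; rewrite /restr_scale rmorph1 scale1r. Qed.
Lemma restr_scaleDr : right_distributive restr_scale +%R.
Proof. by move=> a u v; exact: scalerDr. Qed.
Lemma restr_scaleDl v : {morph restr_scale^~ v : a b / a + b}.
Proof. by move=> a b; rewrite /restr_scale rmorphD; exact: scalerDl. Qed.

HB.instance Definition _ := GRing.Zmodule_isLmodule.Build A restrict
  restr_scaleA restr_scale1 restr_scaleDr restr_scaleDl.
End RestrictScalars.

Definition bilinear_map (A : comNzRingType) (L M N : lmodType A)
    (f : L -> M -> N) : Prop :=
  (forall m : M, linear (f^~ m)) /\ (forall l : L, linear (f l)).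

(* The tensor product, up to unique isomorphism, by its universal property. *)
Definition is_tensor (A : comNzRingType) (L M T : lmodType A)
    (tau : L -> M -> T) : Prop :=
  bilinear_map tau /\
  forall (N : lmodType A) (f : L -> M -> N), bilinear_map f ->
    exists2 g : {linear T -> N}, (forall l m, g (tau l m) = f l m) &
      forall g' : {linear T -> N}, (forall l m, g' (tau l m) = f l m) ->
        g' =1 g.

(* The [B]-module [T] is the tensor product over [A] of [L] and [B], with its
   action of [B] on the second factor. *)
Definition is_base_change (A B : comNzRingType) (f : {rmorphism A -> B})
    (L : lmodType A) (T : lmodType B) (tau : L -> B -> T) : Prop :=
  @is_tensor A L (restrict_scalars f B^o) (restrict_scalars f T) tau /\
  forall (b c : B) (l : L), b *: tau l c = tau l (b * c).

Definition free_module (A : comNzRingType) (M : lmodType A) : Prop :=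
  exists B : {pred M},
    (forall v : M, exists (s : seq M) (c : M -> A),
       {subset s <= B} /\ v = \sum_(u <- s) c u *: u) /\
    (forall (s : seq M) (c : M -> A), uniq s -> {subset s <= B} ->
       \sum_(u <- s) c u *: u = 0 -> {in s, forall u, c u = 0}).

(* Complexes are indexed by the integers; [cdiff C i] goes from degree [i + 1]
   to degree [i]. *)
Record complex (A : comNzRingType) := Complex {
  cterm :> int -> lmodType A;
  cdiff : forall i : int, {linear cterm (i + 1) -> cterm i};
  cdiff_cdiff : forall (i : int) (v : cterm (i + 1 + 1)),
    cdiff i (cdiff (i + 1) v) = 0 }.

Section Complexes.
Variable A : comNzRingType.

Definition complex_iso (C D : complex A) : Prop :=
  exists phi : forall i : int, {linear C i -> D i},
    (forall i : int, bijective (phi i)) /\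
    (forall (i : int) (v : C (i + 1)),
       phi i (cdiff C i v) = cdiff D i (phi (i + 1) v)).

Definition free_complex (C : complex A) : Prop :=
  forall i : int, free_module (C i).

Definition free_resolution (M : lmodType A) (F : complex A) : Prop :=
  [/\ free_complex F,
      forall i : int, i < 0 -> forall v : F i, v = 0,
      forall i : int, 0 <= i -> forall v : F (i + 1), cdiff F i v = 0 ->
        exists w : F (i + 1 + 1), v = cdiff F (i + 1) w &
      exists eps : {linear F 0 -> M},
        (forall m : M, exists v : F 0, eps v = m) /\
        (forall v : F 0, eps v = 0 <-> exists w : F (0 + 1), v = cdiff F 0 w)].
End Complexes.

Section Liftable.
Variables (A B : comNzRingType) (f : {rmorphism A -> B}).

Definition base_change_complex (L : complex A) (T : complex B) : Prop :=
  exists tau : forall i : int, L i -> B -> T i,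
    (forall i : int, is_base_change f (tau i)) /\
    (forall (i : int) (l : L (i + 1)) (b : B),
       cdiff T i (tau (i + 1) l b) = tau i (cdiff L i l) b).

Definition liftable_complex (F : complex B) : Prop :=
  exists L : complex A, free_complex L /\
    exists T : complex B, base_change_complex L T /\ complex_iso T F.

Definition liftable_module (M : lmodType B) : Prop :=
  exists F : complex B, free_resolution M F /\ liftable_complex F.
End Liftable.

Definition quot_residue_module (k : fieldType) (A : kalg k) (x : A)
    (mx : x \in kmax A) : lmodType (quot_x mx) :=
  restrict_scalars (quot_residue mx) k^o.

(* [S] is the subalgebra k (+) ker g, with maximal ideal ker g. *)
Definition is_kernel_subalg (k : fieldType) (A B : kalg k) (g : khom A B)
    (S : ksubalg A) : Prop :=
  (forall r : A, r \in ksub_set S <->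
     exists (c : k) (y : A), g y = 0 /\ r = c%:A + y) /\
  (forall s : S, s \in kmax S <-> g (kincl S s) = 0).

(* Main.v *)
Require Import Defs.
From mathcomp Require Import all_boot all_order all_algebra.
From HB Require Import structures.
From mathcomp Require Import ring boolp.
From mathcomp Require Import freeg.

Set Implicit Arguments.
Unset Strict Implicit.
Unset Printing Implicit Defensive.

Import GRing.Theory.
Local Open Scope ring_scope.

(** Write m for the maximal ideal of R, and Rbar = R/xR.  The hypothesis
    (0 : x) = x^n R makes x nilpotent, x^(n+1) = 0, and it is symmetric: also
    (0 : x^n) = xR ([exact_pair_sym]).  Both equalities pass to free modules
    ([free_exact_pair]): there xv = 0 forces v in x^n L, and x^n v = 0
    forces v in xL.

    From a retraction to a lifting.  A retraction g makes k[x] an R-module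
    along g.  Let L be an R-free resolution of this module.  Then L/xL is
    exact in positive degrees: if dv = aw with a in {x, x^n} and b the other
    element of the pair, applying d once more gives dw = bu, and the same
    assertion one degree below, with a and b exchanged, writes w as bu' + dz,
    whence dv = a dz and v - az is a cycle.  In degree 0 the argument uses the
    module instead of d, since k[x] has the same annihilators of x and x^n
    ([resol_mod_exact]).  As H_0(L/xL) = k[x]/(x) = k, the complex L/xL is
    an Rbar-free resolution of k, and L lifts it.

    From a lifting to a retraction.  Let L be a complex of free R-modules
    such that L/xL resolves k, and let M = H_0(L).  Then M/xM = k, so M is
    generated by one element m, by nilpotence of x ([lift_cokernel_cyclic]).
    Further x^n m is not 0 in M: if x^j (xm) is a boundary, then exactness of
    L/xL in degree 1 and freeness of L_0 show that x^j m is a boundary up to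
    changing m modulo xM, and descent on j would put a generator of M/xM
    into the boundaries ([lift_socle_neq0]).  So the annihilator I of m meets
    k[x] trivially: a nonzero element of k[x] is a unit times some x^j with
    j <= n, and has x^n as a multiple.  From R = k + xR + I and nilpotence of
    x one gets R = k[x] + I.  Thus R is the direct sum of k[x] and the ideal I,
    and projecting onto k[x] is a retraction ([complement_retraction]).

    Retractions and decompositions.  If g is a retraction, then
    R = k[x] + ker g is a direct sum, k[x] acts on ker g by the product of R,
    and the sum map is the isomorphism of k[x] |x_k (k + ker g) with R
    ([retraction_decomposition]).  Conversely, the first projection of a
    decomposition is a retraction whose kernel is the maximal ideal of S
    ([decomposition_retraction]). *)

(** * Homomorphisms of pointed algebras *)

Section KhomBuild.
Variables (k : fieldType) (A B : kalg k) (g : A -> B).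
Hypotheses (gB : zmod_morphism g) (gM : monoid_morphism g) (gZ : scalable g).
Hypothesis gm : forall a, a \in kmax A -> g a \in kmax B.

(** A name for [g] that records the proofs, so that the instances below can
    be attached to it. *)
Definition khom_map of zmod_morphism g & monoid_morphism g & scalable g := g.
HB.instance Definition _ :=
  GRing.isZmodMorphism.Build A B (khom_map gB gM gZ) gB.
HB.instance Definition _ :=
  GRing.isMonoidMorphism.Build A B (khom_map gB gM gZ) gM.
HB.instance Definition _ :=
  GRing.isScalable.Build k A B *:%R (khom_map gB gM gZ) gZ.

Definition khom_build : khom A B := @KHom k A B (khom_map gB gM gZ) gm.

Lemma khom_buildE a : khom_build a = g a.
Proof. by []. Qed.
End KhomBuild.

Section KhomTheory.
Variables (k : fieldType) (A B : kalg k) (g : khom A B).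
Lemma khom0 : g 0 = 0. Proof. exact: raddf0. Qed.
Lemma khom1 : g 1 = 1. Proof. exact: rmorph1. Qed.
Lemma khomD a b : g (a + b) = g a + g b. Proof. exact: raddfD. Qed.
Lemma khomB a b : g (a - b) = g a - g b. Proof. exact: raddfB. Qed.
Lemma khomM a b : g (a * b) = g a * g b. Proof. exact: rmorphM. Qed.
Lemma khomX a i : g (a ^+ i) = g a ^+ i. Proof. exact: rmorphXn. Qed.
Lemma khomZ c a : g (c *: a) = c *: g a. Proof. exact: linearZ. Qed.

Lemma residue_khom a : residue (g a) = residue a.
Proof.
apply: residueP; rewrite -khom1 -khomZ -khomB.
exact/khomP/residue_max.
Qed.
End KhomTheory.

Section ResidueTheory.
Variables (k : fieldType) (A : kalg k).

Lemma kmaxE (a : A) : (a \in kmax A) = (residue a == 0).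
Proof.
apply/idP/eqP => [ma|a0].
  by apply: residueP; rewrite scale0r subr0.
by have := residue_max a; rewrite a0 scale0r subr0.
Qed.

Lemma residue0 : residue (0 : A) = 0.
Proof. by apply/eqP; rewrite -kmaxE; have [] := kmax_ideal A. Qed.

Lemma residueD (a b : A) : residue (a + b) = residue a + residue b.
Proof.
by have := @residue_zmod k A (a + b) b; rewrite addrK => ->; rewrite subrK.
Qed.

Lemma residueM (a b : A) : residue (a * b) = residue a * residue b.
Proof. exact: (residue_monoid A).2. Qed.

Lemma residue_scalar (c : k) : residue (c%:A : A) = c.
Proof. by apply: residueP; rewrite subrr; have [] := kmax_ideal A. Qed.
End ResidueTheory.

(** * Retractions and semi-fiber product decompositions *)

Section KernelSubalgebra.
Variables (k : fieldType) (R : kalg k) (x : R) (mx : x \in kmax R).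
Local Notation kx := (gen_ksubalg mx).
Variable g : khom R kx.
Hypothesis retr : is_retraction (kincl kx) g.

Lemma retractionK (t : kx) : g (kincl kx t) = t.
Proof. by case: retr. Qed.

Definition kersub : {pred R} :=
  fun r => `[< exists (c : k) (y : R), g y = 0 /\ r = c%:A + y >].

Lemma kersub_closed : subalg_closed kersub.
Proof.
split=> [|a u v /asboolP[c [y [gy ->]]] /asboolP[d [z [gz ->]]]
         |u v /asboolP[c [y [gy ->]]] /asboolP[d [z [gz ->]]]]; apply/asboolP.
- by exists 1, 0; rewrite khom0 scale1r addr0.
- exists (a * c + d), (a *: y + z); split.
    by rewrite khomD khomZ gy gz scaler0 addr0.
  by rewrite scalerDr scalerDl -scalerA addrACA.
- exists (c * d), (c *: z + y * (d%:A + z)); split.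
    by rewrite khomD khomZ khomM gy gz scaler0 mul0r addr0.
  by rewrite mulrDl !mulr_algl scalerDr scalerA addrA.
Qed.

HB.instance Definition _ := GRing.isSubalgClosed.Build k R kersub
  (GRing.subalg_closed_semi kersub_closed).

Definition kersub_max : {pred subalg kersub} :=
  [pred s | g (subalg_val s) == 0].

Lemma ker_kmax (r : R) : g r = 0 -> r \in kmax R.
Proof.
by move=> gr; rewrite kmaxE -(residue_khom g) gr -kmaxE; have [] := kmax_ideal kx.
Qed.

Lemma kersub_maxP (s : subalg kersub) :
  s \in kersub_max -> subalg_val s \in kmax R.
Proof. by move/eqP/ker_kmax. Qed.

Lemma kersub_pointed : pointed_by kersub_max.
Proof.
apply: pointed_byI => [|r]; last first.
  have /asboolP[c [y [gy Er]]] := valP r; exists c; apply/eqP.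
  have -> : subalg_val (r - c%:A) = y; last by [].
  have -> : subalg_val (r - c%:A) = val r - c%:A by [].
  by rewrite Er addrC addKr.
split=> [||a u v /eqP gu /eqP gv].
- exact/eqP/khom0.
- by apply/negP => /eqP g1; have /eqP := oner_neq0 kx; rewrite -(khom1 g).
- apply/eqP; have -> : subalg_val (a * u + v) = val a * val u + val v by [].
  by rewrite khomD khomM gu gv mulr0 addr0.
Qed.

Definition ker_ksubalg : ksubalg R := KSubalg kersub_pointed kersub_maxP.
Local Notation S := ker_ksubalg.

Lemma ker_kernel_subalg : is_kernel_subalg g S.
Proof.
split=> [r|s]; first by split=> [/asboolP|h] //; apply/asboolP.
by split=> [/eqP|h] //; apply/eqP.
Qed.

Lemma kmaxT_ker (y : kmaxT S) : g (kincl S (kmaxT_val y)) = 0.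
Proof. by have /eqP := valP y. Qed.

Lemma ker_mem (r : R) : g r = 0 -> r \in kersub.
Proof. by move=> gr; apply/asboolP; exists 0, r; rewrite scale0r add0r. Qed.

Lemma ker_elt_max (r : R) (gr : g r = 0) : (Subalg (ker_mem gr) : S) \in kmax S.
Proof. exact/eqP. Qed.

Definition ker_elt (r : R) (gr : g r = 0) : kmaxT S := KmaxT (ker_elt_max gr).

Local Notation kerval y := (kincl S (kmaxT_val y)).

Lemma ker_eltE r gr : kerval (@ker_elt r gr) = r.
Proof. by []. Qed.

Lemma kerval_inj (y z : kmaxT S) : kerval y = kerval z -> y = z.
Proof. by move=> E; apply: kmaxT_inj; apply: val_inj. Qed.

Lemma ker_act_subproof (t : kx) (y : kmaxT S) : g (kincl kx t * kerval y) = 0.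
Proof. by rewrite khomM kmaxT_ker mulr0. Qed.

Definition ker_act (t : kx) (y : kmaxT S) := ker_elt (ker_act_subproof t y).

Lemma ker_actDl y : {morph ker_act^~ y : t t' / t + t'}.
Proof. by move=> t t'; apply: kerval_inj; rewrite /= mulrDl. Qed.
Lemma ker_actDr t : {morph ker_act t : y y' / y + y'}.
Proof. by move=> y y'; apply: kerval_inj; rewrite /= mulrDr. Qed.
Lemma ker_actM t t' y : ker_act (t * t') y = ker_act t (ker_act t' y).
Proof. by apply: kerval_inj; rewrite /= mulrA. Qed.
Lemma ker_act_scalar (l : k) y : ker_act l%:A y = l *: y.
Proof. by apply: kerval_inj; rewrite /= mulr_algl. Qed.
Lemma ker_act_mul t y s :
  ker_act t (kmaxT_mul y s) = kmaxT_mul (ker_act t y) s.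
Proof. by apply: kerval_inj; rewrite /= mulrA. Qed.

Definition ker_action : kaction kx S :=
  KAction ker_actDl ker_actDr ker_actM ker_act_scalar ker_act_mul.

Definition ker_sum (p : semifiber_kalg ker_action) : R := kincl kx p.1 + kerval p.2.

Lemma ker_sum_zmod : zmod_morphism ker_sum.
Proof. by move=> [t y] [u z]; rewrite /ker_sum /= opprD addrACA. Qed.
Lemma ker_sum_monoid : monoid_morphism ker_sum.
Proof.
split=> [|[t y] [u z]]; first by rewrite /ker_sum /= addr0.
rewrite /ker_sum /=; ring.
Qed.
Lemma ker_sum_scale : scalable ker_sum.
Proof. by move=> c [t y]; rewrite /ker_sum /= scalerDr. Qed.
Lemma ker_sum_max p : p \in kmax (semifiber_kalg ker_action) ->
  ker_sum p \in kmax R.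
Proof.
case: p => t y tm; rewrite kmaxE residueD.
have -> : residue (kincl kx t) = 0.
  by rewrite residue_khom; apply/eqP; rewrite -kmaxE.
by rewrite add0r -kmaxE; apply/ker_kmax/kmaxT_ker.
Qed.

(** The inverse of the sum map sends r to (g r, r - g r). *)
Lemma retraction_decomposition : semifiber_decomposition kx S.
Proof.
exists ker_action, (khom_build ker_sum_zmod ker_sum_monoid ker_sum_scale ker_sum_max).
split=> //.
have gr r : g (r - kincl kx (g r)) = 0 by rewrite khomB retractionK subrr.
exists (fun r => (g r, ker_elt (gr r))) => [[t y]|r].
  have gt : g (kincl kx t + kerval y) = t by rewrite khomD retractionK kmaxT_ker addr0.
  congr pair => //; apply: kerval_inj.
  rewrite ker_eltE [X in X - _]/(kincl kx t + kerval y).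
  by rewrite gt addrC addKr.
by rewrite khom_buildE /ker_sum ker_eltE addrC subrK.
Qed.
End KernelSubalgebra.

Section DecompositionRetraction.
Variables (k : fieldType) (R : kalg k) (T S : ksubalg R).

(** The retraction is the first component of the inverse of the decomposition;
    the elements it kills are those of the second component, that is, the
    maximal ideal of S. *)
Lemma decomposition_retraction : semifiber_decomposition T S ->
  exists g : khom R T, is_retraction (kincl T) g /\ is_kernel_subalg g S.
Proof.
case=> act [phi [[psi phiK psiK] phiE]].
pose g r : T := (psi r).1.
have gB : zmod_morphism g.
  move=> r s; rewrite /g; have -> : psi (r - s) = psi r - psi s; last by [].
  by apply: (can_inj phiK); rewrite khomB !psiK.
have gM : monoid_morphism g.
  split=> [|r s]; rewrite /g.
    by have -> : psi 1 = 1; last by []; apply: (can_inj phiK); rewrite psiK khom1.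
  have -> : psi (r * s) = psi r * psi s; last by [].
  by apply: (can_inj phiK); rewrite khomM !psiK.
have gZ : scalable g.
  move=> c r; rewrite /g; have -> : psi (c *: r) = c *: psi r; last by [].
  by apply: (can_inj phiK); rewrite khomZ !psiK.
have phi1 t : phi (t, 0) = kincl T t by rewrite phiE khom0 addr0.
have phi2 y : phi (0, y) = kincl S (kmaxT_val y) by rewrite phiE khom0 add0r.
have gT t : g (kincl T t) = t by rewrite /g -phi1 phiK.
have gS y : g (kincl S (kmaxT_val y)) = 0 by rewrite /g -phi2 phiK.
have ker r : g r = 0 -> exists y, r = kincl S (kmaxT_val y).
  by rewrite /g => r0; exists (psi r).2; rewrite -phi2 -r0 -surjective_pairing psiK.
have gm r : r \in kmax R -> g r \in kmax T.
  rewrite -[r]psiK; case: (psi r) => t y; rewrite /g phiK /=.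
  rewrite phiE !kmaxE residueD !residue_khom.
  have /eqP -> : residue (kmaxT_val y) == 0 by rewrite -kmaxE; exact: valP.
  by rewrite addr0 -kmaxE.
exists (khom_build gB gM gZ gm); split.
  split; last exact: gT; last by move=> t; exists (kincl T t); exact: gT.
  exact: can_inj gT.
split=> [r|s].
  split=> [rS|[c [y [/ker[z ->] ->]]]]; last first.
    exact: (valP (c%:A + kmaxT_val z)).
  pose s : S := Subalg rS; exists (residue s), (kincl S (s - (residue s)%:A)).
  split; first exact: (gS (KmaxT (residue_max s))).
  by rewrite khomB khomZ khom1 addrC subrK.
split=> [sm|/ker[y /val_inj ->]]; last exact: valP.
exact: (gS (KmaxT sm)).
Qed.
End DecompositionRetraction.

(** * A retraction from a complementary ideal *)

Section ComplementRetraction.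
Variables (k : fieldType) (R : kalg k) (T : ksubalg R) (I : {pred R}).
Hypotheses (I0 : 0 \in I)
           (ID : forall a u v, u \in I -> v \in I -> a * u + v \in I)
           (Im : {subset I <= kmax R}).
Hypothesis TI_span : forall r : R, exists t : T, r - kincl T t \in I.
Hypothesis TI_inj : forall t : T, kincl T t \in I -> t = 0.

(** When [R] is the direct sum of the subalgebra [T] and the ideal [I], the
    projection onto [T] is multiplicative because [I] is an ideal. *)
Lemma complement_retraction :
  exists g : khom R T, is_retraction (kincl T) g.
Proof.
have IB u v : u \in I -> v \in I -> u - v \in I.
  by move=> Iu Iv; have := ID (-1) Iv Iu; rewrite mulN1r addrC.
have IM a u : u \in I -> a * u \in I by move=> Iu; rewrite -[_ * _]addr0 ID.
pose g r := sval (cid (TI_span r)).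
have gP r : r - kincl T (g r) \in I by rewrite /g; case: cid.
have gE r t : r - kincl T t \in I -> g r = t.
  move=> rt; apply/eqP; rewrite -subr_eq0; apply/eqP/TI_inj.
  have := IB _ _ rt (gP r).
  by congr (_ \in I); rewrite khomB; ring.
have gB : zmod_morphism g.
  move=> r s; apply: gE; have := IB _ _ (gP r) (gP s).
  by congr (_ \in I); rewrite khomB; ring.
have gM : monoid_morphism g.
  split=> [|r s]; apply: gE; first by rewrite khom1 subrr.
  have := ID s (gP r) (IM (kincl T (g r)) _ (gP s)).
  by congr (_ \in I); rewrite khomM; ring.
have gZ : scalable g.
  move=> c r; apply: gE; have := IM c%:A _ (gP r).
  by rewrite mulr_algl scalerBr khomZ.
have gm r : r \in kmax R -> g r \in kmax T.
  have -> : r = (r - kincl T (g r)) + kincl T (g r) by rewrite subrK.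
  rewrite kmaxE residueD; have /Im := gP r; rewrite kmaxE => /eqP ->.
  by rewrite add0r residue_khom subrK -kmaxE.
have gT t : g (kincl T t) = t by apply: gE; rewrite subrr.
exists (khom_build gB gM gZ gm); split; [exact: can_inj gT| |exact: gT].
by move=> t; exists (kincl T t); exact: gT.
Qed.
End ComplementRetraction.

(** * Exact pairs of elements *)

Section ExactPair.
Variables (A : comNzRingType) (x : A) (n : nat).
Hypothesis xn : forall r, r * x = 0 <-> exists a, r = x ^+ n * a.

Lemma exact_pair_nilp : x ^+ n.+1 = 0.
Proof. by rewrite exprSr; apply/xn; exists 1; rewrite mulr1. Qed.

(** One proves (0 : x^j) = x^(n+1-j) R by induction on j: an element r with
    r x^(j+1) = 0 satisfies r x^j = x^n a, so r - x^(n-j) a kills x^j. *)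
Lemma exact_pair_sym r : r * x ^+ n = 0 <-> exists a, r = x * a.
Proof.
split=> [|[a ->]]; last by rewrite mulrAC -exprS exact_pair_nilp mul0r.
suff h j : (j <= n)%N -> r * x ^+ j = 0 -> exists a, r = x ^+ (n.+1 - j) * a.
  by move/h => /(_ (leqnn n)); rewrite subSnn.
elim: j r => [|j IH] r jn; first by rewrite mulr1 => ->; exists 0; rewrite mulr0.
rewrite exprSr mulrA => /xn[a Ea].
have [|b Eb] := IH (r - x ^+ (n - j) * a) (ltnW jn).
  by rewrite mulrBl Ea mulrAC -exprD subnK ?subrr // ltnW.
exists (a + x * b); rewrite mulrDr mulrA -exprSr subSS -subSn ?(ltnW jn) //.
by rewrite -Eb addrC subrK.
Qed.
End ExactPair.

(** The annihilator condition holds coordinatewise in a basis.  The sequence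
    that writes a vector may repeat elements of the basis, so it is first made
    duplicate-free, which multiplies the coefficients by multiplicities. *)
Lemma free_exact_pair (A : comNzRingType) (M : lmodType A) (a b : A) :
  free_module M -> (forall r, r * a = 0 -> exists c, r = b * c) ->
  forall v : M, a *: v = 0 -> exists w, v = b *: w.
Proof.
case=> B [span ind] ab v; have [s [c [sB ->]]] := span v => av.
pose c' u := c u *+ count_mem u s.
have E : \sum_(u <- s) c u *: u = \sum_(u <- undup s) c' u *: u.
  rewrite -(big_undup_iterop_count _ s) /=; apply: eq_bigr => u _.
  by rewrite /c' -scalerMnl.
have c0 : {in undup s, forall u, a * c' u = 0}.
  apply: ind => [||]; first exact: undup_uniq.
    by move=> u; rewrite mem_undup; exact: sB.
  rewrite -[RHS]av E scaler_sumr; apply: eq_bigr => u _.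
  by rewrite scalerA.
have /choice[h hP] u : exists h, u \in undup s -> c' u = b * h.
  have [us|] := boolP (u \in undup s); last by exists 0.
  by have [|h ->] := ab (c' u); [rewrite mulrC c0|exists h].
exists (\sum_(u <- undup s) h u *: u); rewrite E scaler_sumr.
by apply: eq_big_seq => u us; rewrite hP // scalerA.
Qed.

(** * The cokernel of a lifting of the resolution of k *)

(** The low degrees L2 -> L1 -> L0 of a lifting, where [e] is the composition
    of L0 -> L0/xL0 with the augmentation onto k; [e0] and [H1] express that
    L/xL has homology k in degree 0 and zero in degree 1. *)
Section LiftedCokernel.
Variables (k : fieldType) (R : kalg k) (x : R) (n : nat).
Hypothesis mx : x \in kmax R.
Hypothesis xn : forall r, r * x = 0 <-> exists a, r = x ^+ n * a.
Variables (L0 L1 L2 : lmodType R).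
Variables (d1 : {linear L1 -> L0}) (d2 : {linear L2 -> L1}).
Hypothesis d12 : forall w, d1 (d2 w) = 0.
Variable e : L0 -> k.
Hypotheses (eD : forall u v, e (u + v) = e u + e v)
           (eZ : forall a v, e (a *: v) = residue a * e v).
Variable m : L0.
Hypothesis em : e m = 1.
Hypothesis e0 : forall v, e v = 0 <-> exists u w, v = x *: u + d1 w.
Hypothesis H1 : forall v u, d1 v = x *: u -> exists v' w, v = x *: v' + d2 w.
Hypothesis L0x : forall u : L0, x *: u = 0 -> exists v, u = x ^+ n *: v.
Local Notation kx := (gen_ksubalg mx).

Let res_x : residue x = 0.
Proof. by apply/eqP; rewrite -kmaxE. Qed.

Let I : {pred R} := fun r => `[< exists w : L1, r *: m = d1 w >].

Lemma lift_aug_boundary w : e (d1 w) = 0.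
Proof. by apply/e0; exists 0, w; rewrite scaler0 add0r. Qed.

(** With j = n and u = m: x^n does not kill the class of m in L0 / d L1.
    In the descent, d w = x^(j+1) u and [H1] write w as x v modulo boundaries;
    then d v - x^j u is killed by x, hence lies in x^n L0, and its x^n y is
    absorbed into u without changing [e u]. *)
Lemma lift_socle_neq0 j u w : (j <= n)%N -> e u != 0 -> x ^+ j *: u != d1 w.
Proof.
elim: j u w => [|j IH] u w jn eu; apply/eqP => E.
  by case/eqP: eu; rewrite -[u]scale1r -(expr0 x) E lift_aug_boundary.
have [|v [z Ew]] := H1 (v := w) (u := x ^+ j *: u).
  by rewrite -E exprS scalerA.
have [|y Ey] := L0x (u := d1 v - x ^+ j *: u).
  rewrite scalerBr scalerA -exprS E Ew linearD d12 addr0 linearZ /=.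
  by rewrite subrr.
have /eqP[] : x ^+ j *: (u + x ^+ (n - j) *: y) != d1 v.
  apply: IH; first exact: ltnW.
  rewrite eD eZ; have -> : residue (x ^+ (n - j)) = 0.
    by rewrite -(subnSK jn) exprS residueM res_x mul0r.
  by rewrite mul0r addr0.
by rewrite scalerDr scalerA -exprD subnKC ?(ltnW jn) // -Ey addrC subrK.
Qed.

(** Nakayama for the nilpotent x: each step pushes the remainder into a higher
    power of x. *)
Lemma lift_cokernel_cyclic u : exists s w, u = s *: m + d1 w.
Proof.
suff h j : exists s v w, u = s *: m + x ^+ j *: v + d1 w.
  have [s [v [w ->]]] := h n.+1; exists s, w.
  by rewrite (exact_pair_nilp xn) scale0r addr0.
elim: j => [|j [s [v [w Eu]]]].
  by exists 0, u, 0; rewrite scale0r add0r scale1r linear0 addr0.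
have /e0[v' [w' Ev]] : e (v - (e v)%:A *: m) = 0.
  by rewrite -scaleNr -scaleNr eD eZ residue_scalar em mulr1 subrr.
exists (s + x ^+ j * (e v)%:A), v', (w + x ^+ j *: w').
rewrite Eu -{1}[v](subrK ((e v)%:A *: m)) Ev linearD linearZ /=.
rewrite !scalerDr scalerDl !scalerA exprSr.
by rewrite [LHS](AC (1*3*1) (1*4*2*(5*3))).
Qed.

(** The annihilator of the class of m in the cokernel is a complement of
    k[x] in R. *)
Lemma lifted_cokernel_retraction :
  exists g : khom R kx, is_retraction (kincl kx) g.
Proof.
have I0 : 0 \in I by apply/asboolP; exists 0; rewrite scale0r linear0.
have ID a u v : u \in I -> v \in I -> a * u + v \in I.
  move=> /asboolP[w Ew] /asboolP[z Ez]; apply/asboolP; exists (a *: w + z).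
  by rewrite linearP /= -Ew -Ez scalerDl scalerA.
have Im : {subset I <= kmax R}.
  move=> r /asboolP[w Ew]; rewrite kmaxE.
  by rewrite -[residue r]mulr1 -em -eZ Ew lift_aug_boundary.
have Rstep r : exists (c : k) (s : R), r - c%:A - x * s \in I.
  have /e0[u [w E]] : e ((r - (residue r)%:A) *: m) = 0.
    by rewrite eZ em mulr1; apply/eqP; rewrite -kmaxE residue_max.
  have [s [z Eu]] := lift_cokernel_cyclic u.
  exists (residue r), s; apply/asboolP; exists (x *: z + w).
  rewrite scalerBl E Eu scalerDr scalerA linearP /=.
  by rewrite [LHS](AC (2*1*1) (1*4*(2*3))) /= subrr add0r.
apply: (@complement_retraction k R kx I) => // [r|t].
  suff h j : exists (t : kx) (s : R), r - kincl kx t - x ^+ j * s \in I.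
    by have [t [s]] := h n.+1; rewrite (exact_pair_nilp xn) mul0r subr0; exists t.
  elim: j => [|j [t [s rI]]]; first by exists 0, r; rewrite mul1r khom0 subr0 subrr.
  have [c [s' sI]] := Rstep s.
  exists (t + c *: (gen_elt x) ^+ j), s'.
  have := ID (x ^+ j) _ _ sI rI.
  rewrite khomD khomZ rmorphXn /= -(mulr_algl c (x ^+ j)) exprSr.
  by congr (_ \in I); ring.
have xnI : x ^+ n \notin I.
  apply/asboolP => -[w /eqP]; apply/negP/lift_socle_neq0 => //.
  by rewrite em oner_neq0.
move=> tI; apply: val_inj; rewrite [RHS]/(0 : R).
(* If t = x^j (c + x s') lies in I and c is not 0, then c^-1 x^(n-j) t = x^n
   lies in I; so t is divisible by every power of x. *)
suff h j : (j <= n.+1)%N -> exists s : kx, t = gen_elt x ^+ j * s.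
  have [s ->] := h n.+1 (leqnn _).
  by rewrite [LHS](khomM (kincl kx)) rmorphXn /= (exact_pair_nilp xn) mul0r.
elim: j => [|j IH] jn; first by exists t; rewrite mul1r.
have [s Et] := IH (ltnW jn); have [c [s' Es]] := gen_subalgE s.
exists s'; rewrite exprSr -mulrA Et; congr (_ * _).
rewrite Es; suff -> : c = 0 by rewrite scale0r add0r.
apply: contraNeq xnI => c0.
have := ID (c^-1%:A * x ^+ (n - j)) _ _ tI I0; rewrite addr0; congr (_ \in I).
have -> : kincl kx t = x ^+ j * (c%:A + x * kincl kx s').
  by rewrite Et Es !(khomM, khomD, khomZ) khom1 rmorphXn.
rewrite mulrA -[_ * x ^+ j]mulrA -exprD subnK // mulrDr mulrA.
rewrite -[_ * x ^+ n * x]mulrA -exprSr (exact_pair_nilp xn) mulr0 mul0r addr0.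
by rewrite mulrAC -scalerAl mul1r scalerA mulVf // scale1r mul1r.
Qed.

End LiftedCokernel.

(** * Quotient modules *)

Section QuotientModule.
Variables (A : comNzRingType) (L : lmodType A) (N : {pred L}).
Hypothesis N_closed : submod_closed N.
Local Open Scope quotient_scope.

(** The closure proof is recorded in the name of the predicate, to carry the
    closed structure that the quotient of abelian groups asks for. *)
Definition submod_pred of submod_closed N : {pred L} := N.
Local Notation N' := (submod_pred N_closed).

HB.instance Definition _ :=
  GRing.isZmodClosed.Build L N' (GRing.submod_closedB N_closed).

Definition quotmod : Type := (Quotient.quot N').
HB.instance Definition _ := GRing.Zmodule.on quotmod.

Definition quotmod_pi : L -> quotmod := \pi_(Quotient.quot N').

Lemma quotmod_piP u v : quotmod_pi u = quotmod_pi v <-> u - v \in N.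
Proof.
have -> : (u - v \in N) = (quotmod_pi u == quotmod_pi v).
  exact: (@Quotient.idealrBE L N' u v).
by split=> /eqP.
Qed.

Lemma quotmod_pi_repr q : quotmod_pi (repr q) = q.
Proof. exact: reprK. Qed.

Lemma quotmod_piB : zmod_morphism quotmod_pi.
Proof. exact: raddfB. Qed.
HB.instance Definition _ :=
  GRing.isZmodMorphism.Build L quotmod quotmod_pi quotmod_piB.

Definition quotmod_scale a (q : quotmod) : quotmod := quotmod_pi (a *: repr q).

Lemma quotmod_scaleE a v : quotmod_scale a (quotmod_pi v) = quotmod_pi (a *: v).
Proof.
apply/quotmod_piP; rewrite -scalerBr.
have [N0 Nlin] := N_closed; rewrite -[_ *: _]addr0; apply: Nlin => //.
by apply/quotmod_piP; rewrite quotmod_pi_repr.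
Qed.

Let quotW (P : quotmod -> Prop) : (forall v, P (quotmod_pi v)) -> forall q, P q.
Proof. by move=> h q; rewrite -[q]quotmod_pi_repr. Qed.

Lemma quotmod_scaleA a b v :
  quotmod_scale a (quotmod_scale b v) = quotmod_scale (a * b) v.
Proof. by elim/quotW: v => v; rewrite !quotmod_scaleE scalerA. Qed.
Lemma quotmod_scale1 : left_id 1 quotmod_scale.
Proof. by elim/quotW=> v; rewrite quotmod_scaleE scale1r. Qed.
Lemma quotmod_scaleDr : right_distributive quotmod_scale +%R.
Proof.
move=> a; elim/quotW=> u; elim/quotW=> v.
by rewrite -raddfD !quotmod_scaleE scalerDr raddfD.
Qed.
Lemma quotmod_scaleDl v : {morph quotmod_scale^~ v : a b / a + b}.
Proof.
by elim/quotW: v => v a b; rewrite !quotmod_scaleE scalerDl raddfD.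
Qed.
HB.instance Definition _ := GRing.Zmodule_isLmodule.Build A quotmod
  quotmod_scaleA quotmod_scale1 quotmod_scaleDr quotmod_scaleDl.

Lemma quotmod_piZ : scalable quotmod_pi.
Proof. by move=> a v; rewrite -quotmod_scaleE. Qed.
HB.instance Definition _ :=
  GRing.isScalable.Build A L quotmod *:%R quotmod_pi quotmod_piZ.

Lemma quotmod_pi_eq0 v : quotmod_pi v = 0 <-> v \in N.
Proof. by rewrite -(raddf0 quotmod_pi) quotmod_piP subr0. Qed.

End QuotientModule.

(** * Base change along a quotient by a principal ideal *)

Section Reduction.
Variables (A B : comNzRingType) (f : {rmorphism A -> B}) (x : A).
Hypothesis f_surj : forall b, exists a, f a = b.
Hypothesis f_ker : forall a, f a = 0 <-> exists c, a = x * c.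

(** [p] identifies [T] with L/xL; this is the concrete form of the base change
    of [L] along [f]. *)
Definition reduction (L : lmodType A) (T : lmodType B) (p : L -> T) : Prop :=
  [/\ forall a u v, p (a *: u + v) = f a *: p u + p v,
      forall t, exists l, p l = t
    & forall l, p l = 0 <-> exists l', l = x *: l'].

Lemma reductionD (L : lmodType A) (T : lmodType B) (p : L -> T) :
  reduction p -> forall u v, p (u + v) = p u + p v.
Proof. by case=> h _ _ u v; have := h 1 u v; rewrite rmorph1 !scale1r. Qed.

Lemma reduction0 (L : lmodType A) (T : lmodType B) (p : L -> T) :
  reduction p -> p 0 = 0.
Proof. by move=> h; apply: (addrI (p 0)); rewrite -(reductionD h) !addr0. Qed.

Lemma reductionZ (L : lmodType A) (T : lmodType B) (p : L -> T) :
  reduction p -> forall a v, p (a *: v) = f a *: p v.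
Proof.
by move=> h a v; have [l _ _] := h; rewrite -[_ *: v]addr0 l (reduction0 h) addr0.
Qed.

Lemma reduction_eq (L : lmodType A) (T : lmodType B) (p : L -> T) :
  reduction p -> forall u v, p u = p v <-> exists w, u - v = x *: w.
Proof.
move=> h u v; have [_ _ <-] := h.
rewrite -scaleN1r (reductionD h) (reductionZ h) rmorphN1 scaleN1r.
by split=> [->|/eqP]; rewrite ?subrr // subr_eq0 => /eqP.
Qed.

(** A bilinear map g on L x B is determined by g(., 1), which vanishes on xL
    because f x = 0; so it factors through L/xL. *)
Lemma reduction_base_change (L : lmodType A) (T : lmodType B) (p : L -> T) :
  reduction p -> is_base_change f (fun (l : L) (b : B) => b *: p l : T).
Proof.
move=> hp; have [plin psurj pker] := hp; split; last by move=> b c l; rewrite scalerA.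
split.
  split=> [b a u v|l a b c].
    by rewrite /= (reductionD hp) (reductionZ hp) scalerDr scalerA mulrC -scalerA.
  by rewrite /= scalerDl -[RHS]/(f a *: (b *: p l) + _) scalerA.
move=> N g [glin1 glin2].
have g1 l b c : g l (f b * c) = b *: g l c.
  have := glin2 l b c 0; rewrite addr0.
  have -> : g l 0 = 0.
    by have := glin2 l (-1) 0 0; rewrite addr0 !scaleN1r addNr => <-; rewrite oppr0.
  by rewrite addr0.
have gD l l' : g (l + l') 1 = g l 1 + g l' 1.
  by have := glin1 1 1 l l'; rewrite !scale1r.
have g0 : g 0 1 = 0 by apply: (addrI (g 0 1)); rewrite -gD !addr0.
have gx l : g (x *: l) 1 = 0.
  have := glin1 1 x l 0; rewrite /= addr0 g0 addr0 => ->; rewrite -g1 mulr1.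
  have -> : f x = 0 by apply/f_ker; exists 1; rewrite mulr1.
  rewrite -(rmorph0 f) -[f 0]mulr1 g1 scale0r //.
(* s is a section of p; the factorization sends t to g (s t) 1. *)
pose s t := sval (cid (psurj t)).
have sK t : p (s t) = t by rewrite /s; case: cid.
have gs l t : p l = t -> g (s t) 1 = g l 1.
  move=> Et; have /(reduction_eq hp)[w E] : p (s t) = p l by rewrite sK.
  by rewrite -[s t](subrK l) E gD gx add0r.
pose h (t : restrict_scalars f T) : N := g (s t) 1.
have hlin : linear h.
  move=> a t u; rewrite /h (gs (a *: s t + s u)) ?plin ?sK //.
  by have := glin1 1 a (s t) (s u).
pose H : {linear restrict_scalars f T -> N} :=
  HB.pack h (GRing.isLinear.Build _ _ _ _ h hlin).
exists H => [l b|H' HE t].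
  have [a <-] := f_surj b.
  rewrite [LHS](gs (a *: l)) ?(reductionZ hp) // -[f a]mulr1 g1.
  by have := glin1 1 a l 0; rewrite g0 !addr0.
by rewrite -[in LHS](sK t) -[p _]scale1r HE.
Qed.

(** Surjectivity and the kernel come from testing the universal property on
    quotient modules: uniqueness for maps to T modulo the elements tau(l, 1) shows that
    these are all of T, and the bilinear map (l, b) |-> bl to L/xL shows that
    tau(l, 1) = 0 only for l in xL. *)
Lemma base_change_reduction (L : lmodType A) (T : lmodType B) (tau : L -> B -> T) :
  is_base_change f tau -> reduction (fun l => tau l 1).
Proof.
case=> -[[tau1 tau2] univ] act.
have tau0 : tau 0 1 = 0.
  by have := tau1 1 (-1) 0 0; rewrite scaler0 addr0 scaleN1r addNr.
split=> [a u v|t|l].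
- exact: (tau1 1 a u v).
- pose I : {pred restrict_scalars f T} := fun t => `[< exists l, tau l 1 = t >].
  have I_closed : submod_closed I.
    split=> [|a u v /asboolP[l <-] /asboolP[l' <-]]; apply/asboolP.
      by exists 0.
    by exists (a *: l + l'); exact: (tau1 1 a l l').
  have I_tau l b : tau l b \in I.
    have [a <-] := f_surj b; apply/asboolP; exists (a *: l).
    have := tau1 1 a l 0; rewrite /= tau0 !addr0 => ->.
    by rewrite -[f a in RHS]mulr1 -act.
  have bil0 : @bilinear_map A L (restrict_scalars f B^o)
      (quotmod I_closed) (fun _ _ => 0).
    by split=> [m|l] a u v; rewrite scaler0 addr0.
  have [g _ uniq] := univ _ _ bil0.
  pose p : {linear restrict_scalars f T -> quotmod I_closed} := quotmod_pi I_closed.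
  pose z : {linear restrict_scalars f T -> quotmod I_closed} := \0.
  have : p t = z t.
    rewrite (uniq p) ?(uniq z) // => l b; exact/quotmod_pi_eq0.
  by move/quotmod_pi_eq0/asboolP.
pose I : {pred L} := fun l => `[< exists l', l = x *: l' >].
have I_closed : submod_closed I.
  split=> [|a u v /asboolP[u' ->] /asboolP[v' ->]]; apply/asboolP.
    by exists 0; rewrite scaler0.
  by exists (a *: u' + v'); rewrite scalerDr !scalerA mulrC.
pose p := quotmod_pi I_closed.
pose s b := sval (cid (f_surj b)).
have sK b : f (s b) = b by rewrite /s; case: cid.
have pE a a' u : f a = f a' -> p (a *: u) = p (a' *: u).
  move=> E; apply/quotmod_piP; rewrite -scalerBl.
  have /f_ker[c ->] : f (a - a') = 0 by rewrite rmorphB E subrr.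
  by apply/asboolP; exists (c *: u); rewrite scalerA.
have bil : @bilinear_map A L (restrict_scalars f B^o) (quotmod I_closed)
    (fun l b => p (s b *: l)).
  split=> [b a u v|u a b c].
    rewrite -[RHS]linearP; congr (p _).
    by rewrite scalerDr !scalerA mulrC.
  rewrite -[RHS]linearP scalerA -scalerDl; apply: pE.
  by rewrite sK rmorphD rmorphM !sK.
have [g gE _] := univ _ _ bil.
split=> [l0|[l' ->]].
  suff /quotmod_pi_eq0/asboolP : p l = 0 by [].
  by rewrite -[l]scale1r -(pE (s 1)) ?sK ?rmorph1 // -gE l0 raddf0.
have := tau1 1 x l' 0; rewrite /= tau0 !addr0 => ->.
rewrite -[LHS]/(f x *: (tau l' 1 : T)).
by have -> : f x = 0; [apply/f_ker; exists 1; rewrite mulr1 | rewrite scale0r].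
Qed.
End Reduction.

(** * From a lifting to a retraction *)

Section QuotMap.
Variables (k : fieldType) (R : kalg k) (x : R) (mx : x \in kmax R).

Lemma quot_map_surj (b : quot_x mx) : exists a, quot_map mx a = b.
Proof. by exists (repr b); exact: reprK. Qed.

Lemma quot_map_ker (a : R) : quot_map mx a = 0 <-> exists c, a = x * c.
Proof.
rewrite -(rmorph0 (quot_map mx)).
split=> [/eqP|[c Ea]]; last apply/eqP.
  by rewrite -Quotient.idealrBE subr0 => /asboolP.
by rewrite -Quotient.idealrBE subr0; apply/asboolP; exists c.
Qed.
End QuotMap.

Section LiftToRetraction.
Variables (k : fieldType) (R : kalg k) (x : R) (n : nat).
Hypothesis mx : x \in kmax R.
Hypothesis xn : forall r, r * x = 0 <-> exists a, r = x ^+ n * a.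

(** The maps [p i] identify L/xL with the resolution, so that exactness of the
    resolution at 0 and 1 becomes the hypotheses on the cokernel of L. *)
Lemma liftable_retraction :
  liftable_module (quot_map mx) (quot_residue_module mx) ->
  exists g : khom R (gen_ksubalg mx), is_retraction (kincl (gen_ksubalg mx)) g.
Proof.
case=> F [[_ _ exF [eps [eps_surj eps_ker]]]].
case=> L [freeL [T [[tau [bc tauC]] [phi [phi_bij phiC]]]]].
pose p i (l : L i) : F i := phi i (tau i l 1).
have pP i : reduction (quot_map mx) x (p i).
  have [psi phiK psiK] := phi_bij i.
  have [lin surj ker] := base_change_reduction (quot_map_surj (mx := mx))
    (quot_map_ker mx) (bc i).
  split=> [a u v|t|l]; first by rewrite /p lin linearP.
    by have [l El] := surj (psi t); exists l; rewrite /p El psiK.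
  rewrite -ker /p; split=> [E|->]; last exact: raddf0.
  by apply: (can_inj phiK); rewrite E raddf0.
have pC i l : p i (cdiff L i l) = cdiff F i (p (i + 1) l).
  by rewrite /p -tauC phiC.
have surj i t : exists l, p i l = t by have [_ h _] := pP i; exact: h.
have [m0 m0E] := eps_surj 1; have [m pm] := surj _ m0.
refine (@lifted_cokernel_retraction _ _ _ n mx xn _ _ _
  (cdiff L 0) (cdiff L (0 + 1)) (cdiff_cdiff (i := 0))
  (fun l => eps (p 0 l)) _ _ m _ _ _ _) => //=.
- by move=> u v; rewrite (reductionD (pP _)) raddfD.
- move=> a v; rewrite (reductionZ (pP _)) linearZ.
  by rewrite -[LHS]/(quot_residue mx (quot_map mx a) * _) quot_residueE.
- by rewrite pm m0E.
- move=> v; rewrite eps_ker; split=> [[w Ev]|[u [w Ev]]].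
    have [w' Ew'] := surj _ w.
    move: Ev; rewrite -Ew' -pC => /(reduction_eq (pP 0))[u Eu].
    by exists u, w'; rewrite -Eu subrK.
  exists (p _ w); rewrite -pC; apply/(reduction_eq (pP 0)).
  by exists u; rewrite Ev addrK.
- move=> v u Ev.
  have [|w Ew] := exF 0 isT (p _ v).
    by rewrite -pC; have [_ _ ker] := pP 0; apply/ker; exists u.
  have [w' Ew'] := surj _ w.
  move: Ew; rewrite -Ew' -pC => /(reduction_eq (pP _))[v' Ev'].
  by exists v', w'; rewrite -Ev' subrK.
- apply: free_exact_pair (freeL 0) _.
  by move=> r /xn.
Qed.
End LiftToRetraction.

(** * Free modules and their reductions *)

Section FreeModule.
Variables (A : comNzRingType) (K : choiceType).

Definition freemod : lmodType A := {freeg K / A}.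

Definition fbasis (y : K) : freemod := << y >>.

Definition fcoord (y : K) (v : freemod) : A := coeff y v.

Lemma fcoordD y u v : fcoord y (u + v) = fcoord y u + fcoord y v.
Proof. exact: coeffD. Qed.

Lemma fcoordZ y a v : fcoord y (a *: v) = a * fcoord y v.
Proof. exact: coeffZ. Qed.

Lemma fcoord0 y : fcoord y 0 = 0.
Proof. exact: coeff0. Qed.

Lemma fcoord_basis y z : fcoord y (fbasis z) = (z == y)%:R.
Proof. by rewrite /fcoord /fbasis coeffU mul1r. Qed.

Lemma fcoord_sum y (I : Type) (s : seq I) (F : I -> freemod) :
  fcoord y (\sum_(i <- s) F i) = \sum_(i <- s) fcoord y (F i).
Proof. exact: (raddf_sum (coeff y : {additive {freeg K / A} -> A})). Qed.

Lemma fcoord_inj u v : (forall y, fcoord y u = fcoord y v) -> u = v.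
Proof. by move=> uv; apply/eqP/freeg_eqP. Qed.

Lemma freemod_span v : v = \sum_(y <- dom v) fcoord y v *: fbasis y.
Proof.
apply: fcoord_inj => z; rewrite -{1}[v]freeg_sumE /fcoord raddf_sum [RHS]fcoord_sum.
by apply: eq_bigr => y _; rewrite fcoordZ fcoord_basis [LHS]coeffU.
Qed.

Lemma freemod_free : free_module freemod.
Proof.
exists (fun v => `[< exists y, v = fbasis y >]); split=> [v|s c us sB E].
  (* Coefficients are indexed by vectors; as [dom (fbasis y)] is [:: y], this
     sum is the coordinate of v at y when u is [fbasis y]. *)
  exists [seq fbasis y | y <- dom v], (fun u => \sum_(z <- dom u) fcoord z v).
  split; first by move=> u /mapP[y _ ->]; apply/asboolP; exists y.
  rewrite {1}[v]freemod_span [RHS]big_map; apply: eq_bigr => y _.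
  by rewrite domU1 big_seq1.
move=> u us0; have /asboolP[y Eu] := sB u us0.
have := congr1 (fcoord y) E; rewrite fcoord_sum fcoord0.
rewrite (bigD1_seq u) //= big_seq_cond big1 ?addr0.
  by rewrite fcoordZ Eu fcoord_basis eqxx mulr1.
move=> w /andP[/sB/asboolP[z Ew] wu]; rewrite fcoordZ Ew fcoord_basis.
case: eqP => [zy|_]; last by rewrite mulr0.
by case/eqP: wu; rewrite Ew Eu zy.
Qed.

Section Ext.
Variables (M : lmodType A) (h : K -> M).

Definition freemod_ext (v : freemod) : M := fglift h v.

Lemma freemod_ext_zmod : zmod_morphism freemod_ext.
Proof. exact: lift_is_additive. Qed.
HB.instance Definition _ :=
  GRing.isZmodMorphism.Build freemod M freemod_ext freemod_ext_zmod.

Lemma freemod_ext_basisZ a y : freemod_ext (a *: fbasis y) = a *: h y.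
Proof.
have -> : a *: fbasis y = << a *g y >>.
  by apply: fcoord_inj => z; rewrite fcoordZ fcoord_basis [RHS]coeffU.
exact: liftU.
Qed.

Lemma freemod_ext_scale : scalable freemod_ext.
Proof.
move=> a v; rewrite [v]freemod_span scaler_sumr [LHS]raddf_sum.
rewrite [in RHS]raddf_sum scaler_sumr.
by apply: eq_bigr => y _; rewrite scalerA /= !freemod_ext_basisZ scalerA.
Qed.
HB.instance Definition _ :=
  GRing.isScalable.Build A freemod M *:%R freemod_ext freemod_ext_scale.

Lemma freemod_ext_basis y : freemod_ext (fbasis y) = h y.
Proof. by rewrite -[fbasis y]scale1r freemod_ext_basisZ scale1r. Qed.
End Ext.
End FreeModule.

Section FreeReduction.
Variables (A B : comNzRingType) (f : {rmorphism A -> B}) (x : A).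
Hypothesis f_surj : forall b, exists a, f a = b.
Hypothesis f_ker : forall a, f a = 0 <-> exists c, a = x * c.
Variable K : choiceType.

(** The coefficientwise image under [f], seen as a map of A-modules. *)
Definition freemod_red : freemod A K -> restrict_scalars f (freemod B K) :=
  freemod_ext (fun y => fbasis B y : restrict_scalars f (freemod B K)).
HB.instance Definition _ := GRing.Linear.on freemod_red.

Lemma freemod_redZ a v :
  freemod_red (a *: v) = f a *: (freemod_red v : freemod B K).
Proof. exact: linearZ. Qed.

Lemma fcoord_red y v : fcoord y (freemod_red v : freemod B K) = f (fcoord y v).
Proof.
rewrite [v]freemod_span raddf_sum /= [LHS]fcoord_sum fcoord_sum rmorph_sum.
apply: eq_bigr => z _; rewrite freemod_redZ !fcoordZ rmorphM; congr (_ * _).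
by rewrite [freemod_red _]freemod_ext_basis !fcoord_basis rmorph_nat.
Qed.

Lemma freemod_red_reduction :
  reduction f x (freemod_red : freemod A K -> freemod B K).
Proof.
split=> [a u v|w|v]; first exact: (linearP freemod_red).
  have /choice[h hP] y : exists a, f a = fcoord y w by exact: f_surj.
  exists (\sum_(y <- dom w) h y *: fbasis A y).
  apply: fcoord_inj => z; rewrite fcoord_red [in RHS](freemod_span w) !fcoord_sum.
  rewrite rmorph_sum; apply: eq_bigr => y _.
  by rewrite !fcoordZ !fcoord_basis rmorphM hP rmorph_nat.
split=> [v0|[w ->]]; last first.
  apply: fcoord_inj => z; rewrite fcoord_red fcoordZ rmorphM fcoord0.
  by have -> : f x = 0; [apply/f_ker; exists 1; rewrite mulr1|rewrite mul0r].
have /choice[h hP] y : exists c, fcoord y v = x * c.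
  by apply/f_ker; rewrite -fcoord_red v0 fcoord0.
exists (\sum_(y <- dom v) h y *: fbasis A y); rewrite {1}[v]freemod_span scaler_sumr.
by apply: eq_bigr => y _; rewrite hP scalerA.
Qed.

(** The endomorphism induced modulo x: the matrix of [d], with the
    coefficients reduced by [f]. *)
Definition freemod_red_map (d : freemod A K -> freemod A K) :
  freemod B K -> freemod B K :=
  freemod_ext (fun y => freemod_red (d (fbasis A y)) : freemod B K).
HB.instance Definition _ d := GRing.Linear.on (freemod_red_map d).

Lemma freemod_red_mapE (d : {linear freemod A K -> freemod A K}) v :
  freemod_red_map d (freemod_red v) = freemod_red (d v).
Proof.
have redZ a y : freemod_red_map d (freemod_red (a *: fbasis A y))
    = freemod_red (d (a *: fbasis A y)).
  rewrite freemod_redZ [RHS](congr1 _ (linearZ_LR d a (fbasis A y))) freemod_redZ.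
  rewrite [LHS]linearZ_LR; congr (_ *: _).
  by rewrite [freemod_red (fbasis A y)]freemod_ext_basis [LHS]freemod_ext_basis.
rewrite [v]freemod_span !raddf_sum.
by apply: eq_bigr => y _; exact: redZ.
Qed.
End FreeReduction.

(** * Complexes on one free module *)

(** The term is the same module in every nonnegative degree.  Then the type of
    a differential from degree m + 1 computes, and no transport between
    modules in equal degrees occurs. *)
Section FreeComplex.
Variables (A : comNzRingType) (X : choiceType).
Local Notation G := (freemod A X).
Variable d : nat -> {linear G -> G}.
Hypothesis dd : forall i v, d i (d i.+1 v) = 0.

Definition cells (i : int) : choiceType := if i is Posz _ then X else void.
Definition free_term (i : int) : lmodType A := freemod A (cells i).

Definition free_diff (i : int) : {linear free_term (i + 1) -> free_term i} :=
  match i with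
  | Posz m => (d m : {linear free_term (Posz m + 1) -> free_term (Posz m)})
  | Negz m => (\0 : {linear free_term (Negz m + 1) -> free_term (Negz m)})
  end.

Lemma free_diff_diff i v : free_diff i (free_diff (i + 1) v) = 0.
Proof.
case: i v => m v //.
have E : forall j (w : G), j = m.+1 -> d m (d j w) = 0 by move=> j w ->; exact: dd.
by apply: E; rewrite addn1.
Qed.

Definition nat_complex : complex A := Complex free_diff_diff.

Lemma nat_complex_free : free_complex nat_complex.
Proof. by move=> i; exact: freemod_free. Qed.
End FreeComplex.

(** * A free module that covers all its submodules *)

(** A set X of generators such that X itself maps onto the free module on X:
    an element of X is a formal linear combination of elements of X.  Every
    submodule of this free module is then the image of an endomorphism
    ([cover_image]), which lets one module serve in all degrees of a
    resolution. *)
Inductive gens (A : Type) : Type := Gens of seq (A * gens A).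
HB.instance Definition _ (A : Type) := gen_eqMixin (gens A).
HB.instance Definition _ (A : Type) := gen_choiceMixin (gens A).

Section Cover.
Variable A : comNzRingType.
Local Notation X := (gens A).
Local Notation G := (freemod A X).

Definition gens_val (y : X) : G := let: Gens s := y in [freeg s].

Lemma gens_val_surj (v : G) : exists y, gens_val y = v.
Proof. by exists (Gens (fgenum v)); exact: Freeg_enum. Qed.

Variable N : {pred G}.

Definition cover : G -> G :=
  freemod_ext (fun y => if gens_val y \in N then gens_val y else 0).
HB.instance Definition _ := GRing.Linear.on cover.

Lemma cover_image (w : G) : submod_closed N -> w \in N <-> exists v, w = cover v.
Proof.
case=> N0 Nlin; split=> [wN|[v ->]].
  have [y Ey] := gens_val_surj w; exists (fbasis A y).
  by rewrite [RHS]freemod_ext_basis Ey wN.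
rewrite [v]freemod_span raddf_sum /=.
elim: (dom v) => [|y s IH]; first by rewrite big_nil.
rewrite big_cons linearZ_LR /=; apply: Nlin => //.
by rewrite [cover _]freemod_ext_basis; case: ifP.
Qed.
End Cover.

(** * From a retraction to a lifting *)

Section RetractionToLift.
Variables (k : fieldType) (R : kalg k) (x : R) (n : nat).
Hypothesis mx : x \in kmax R.
Hypothesis xn : forall r, r * x = 0 <-> exists a, r = x ^+ n * a.
Local Notation kx := (gen_ksubalg mx).
Variable g : khom R kx.
Hypothesis gK : forall t : kx, g (kincl kx t) = t.
Local Notation G := (freemod R (gens R)).

(** The surjection from the free module onto k[x], seen as an R-module along
    [g]: the generator [Gens [::]] maps to 1 and the others to 0. *)
Definition aug (v : G) : kx := g (fcoord (Gens [::]) v).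

Lemma augD u v : aug (u + v) = aug u + aug v.
Proof. by rewrite /aug fcoordD khomD. Qed.
Lemma augZ a v : aug (a *: v) = g a * aug v.
Proof. by rewrite /aug fcoordZ khomM. Qed.
Lemma aug_basis : aug (fbasis R (Gens [::])) = 1.
Proof. by rewrite /aug fcoord_basis eqxx khom1. Qed.

Definition aug_ker : {pred G} := [pred v | aug v == 0].

Lemma aug_ker_closed : submod_closed aug_ker.
Proof.
split; first by apply/eqP; rewrite /aug fcoord0 khom0.
by move=> a u v /eqP u0 /eqP v0; apply/eqP; rewrite augD augZ u0 v0 mulr0 addr0.
Qed.

Definition lin_ker (d : {linear G -> G}) : {pred G} := [pred v | d v == 0].

Lemma lin_ker_closed d : submod_closed (lin_ker d).
Proof.
split; first by apply/eqP; rewrite raddf0.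
by move=> a u v /eqP u0 /eqP v0; apply/eqP; rewrite linearP /= u0 v0 scaler0 addr0.
Qed.

Fixpoint resol (i : nat) : {linear G -> G} :=
  if i is j.+1 then (cover (lin_ker (resol j)) : {linear G -> G})
  else (cover aug_ker : {linear G -> G}).

Lemma resol_aug v : aug v = 0 <-> exists w, v = resol 0 w.
Proof. by rewrite -(cover_image v aug_ker_closed); split=> /eqP. Qed.

Lemma resol_exact i v : resol i v = 0 <-> exists w, v = resol i.+1 w.
Proof. by rewrite -(cover_image v (lin_ker_closed (resol i))); split=> /eqP. Qed.

Lemma resol_resol i v : resol i (resol i.+1 v) = 0.
Proof. by apply/resol_exact; exists v. Qed.

(** Exactness modulo a, for both elements a of the pair at once: the
    induction exchanges them.  In degree 0 the role of the previous
    differential is played by [aug]: if aw lies in the kernel of [aug], then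
    aug w is killed by a in R, hence is a multiple of b there, and applying [g]
    makes it a multiple of b in k[x]; here [g] has to fix a and b. *)
Lemma resol_mod_exact i (a b : R) :
  (forall r, r * a = 0 <-> exists c, r = b * c) ->
  (forall r, r * b = 0 <-> exists c, r = a * c) ->
  kincl kx (g a) = a -> kincl kx (g b) = b ->
  forall v w, resol i v = a *: w -> exists u z, v = a *: u + resol i.+1 z.
Proof.
elim: i a b => [|i IH] a b ab ba ga gb v w E; last first.
  have ab0 : a * b = 0 by apply/ba; exists 1; rewrite mulr1.
  have aw : a *: resol i w = 0 by rewrite -linearZ_LR /= -E resol_resol.
  have [u Eu] := free_exact_pair (freemod_free _ _) (fun r => proj1 (ab r)) aw.
  have [u' [z Ew]] := IH b a ba ab gb ga w u Eu.
  have /resol_exact[z' Ez] : resol i.+1 (v - a *: z) = 0.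
    rewrite linearB linearZ_LR E Ew scalerDr scalerA ab0 scale0r add0r.
    exact: subrr.
  by exists z, z'; rewrite -Ez addrC subrK.
have ab0 : a * b = 0 by apply/ba; exists 1; rewrite mulr1.
have aw : g a * aug w = 0 by rewrite -augZ; apply/resol_aug; exists v.
have /ab[q Eq] : kincl kx (aug w) * a = 0.
  by rewrite mulrC -ga -khomM aw khom0.
have /resol_aug[z Ez] : aug (w - b *: (q *: fbasis R (Gens [::]))) = 0.
  rewrite augD -scaleNr !augZ aug_basis mulr1 -[aug w]gK Eq !khomM.
  have -> : g (- b) = - g b by exact: raddfN.
  by rewrite mulNr subrr.
have /resol_exact[z' Ez'] : resol 0 (v - a *: z) = 0.
  rewrite linearB linearZ_LR E -Ez scalerBr (scalerA a b) ab0 scale0r subr0.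
  by rewrite subrr.
by exists z, z'; rewrite -Ez' addrC subrK.
Qed.

Lemma resol_mod_x i v w : resol i v = x *: w -> exists u z, v = x *: u + resol i.+1 z.
Proof.
have gx : kincl kx (g x) = x by rewrite [g x](gK (gen_elt x)).
apply: (@resol_mod_exact i x (x ^+ n) xn _ gx) => [r|]; last first.
  by rewrite !khomX gx.
exact: exact_pair_sym.
Qed.

Local Notation B := (quot_x mx).
Local Notation f := (quot_map mx).
Local Notation red := (@freemod_red _ _ f (gens R)).
Local Notation o := (Gens [::] : gens R).

Definition resol_red (i : nat) : {linear freemod B (gens R) -> freemod B (gens R)} :=
  freemod_red_map f (resol i).

Let redP K : reduction f x (@freemod_red _ _ f K : freemod R K -> freemod B K) :=
  freemod_red_reduction (quot_map_surj (mx := mx)) (quot_map_ker mx) K.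

Let red_surj (v : freemod B (gens R)) : exists l, red l = v.
Proof. by have [_ h _] := redP (gens R); exact: h. Qed.

Lemma resol_redE i v : resol_red i (red v) = red (resol i v).
Proof. exact: freemod_red_mapE. Qed.

Lemma resol_red_exact i v :
  resol_red i v = 0 <-> exists w, v = resol_red i.+1 w.
Proof.
have [l <-] := red_surj v; rewrite resol_redE; split=> [E|[w]]; last first.
  have [l' <-] := red_surj w; rewrite resol_redE => /(reduction_eq (redP _))[u Eu].
  have [_ _ ker] := redP (gens R).
  apply/ker; exists (resol i u).
  by rewrite -[l](subrK (resol i.+1 l')) Eu linearD linearZ_LR resol_resol addr0.
have [_ _ ker] := redP (gens R).
have /ker[w Ew] := E.
have [u [z Ez]] := resol_mod_x Ew.
exists (red z); rewrite resol_redE; apply/(reduction_eq (redP _)).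
by exists u; rewrite Ez addrK.
Qed.

Definition aug_red (v : freemod B (gens R)) : quot_residue_module mx :=
  quot_residue mx (fcoord o v).

Lemma aug_red_linear : linear aug_red.
Proof. by move=> a u v; rewrite /aug_red fcoordD fcoordZ rmorphD rmorphM. Qed.
HB.instance Definition _ := GRing.isLinear.Build B (freemod B (gens R))
  (quot_residue_module mx) *:%R aug_red aug_red_linear.

Lemma aug_redE v : aug_red (red v) = residue (fcoord o v).
Proof. by rewrite /aug_red fcoord_red quot_residueE. Qed.

Lemma aug_red_surj c : exists v, aug_red v = c.
Proof.
exists (red (c%:A *: fbasis R o)).
by rewrite aug_redE fcoordZ fcoord_basis eqxx mulr1 residue_scalar.
Qed.

(** If aug_red (red l) = 0, then aug l lies in xk[x], so subtracting
    a multiple of x from l puts it in the kernel of [aug]. *)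
Lemma aug_red_exact v : aug_red v = 0 <-> exists w, v = resol_red 0 w.
Proof.
have [l <-] := red_surj v; rewrite aug_redE; split=> [E|[w]]; last first.
  have [l' <-] := red_surj w; rewrite resol_redE => /(reduction_eq (redP _))[u Eu].
  have /(congr1 (@residue k kx)) : aug (resol 0 l') = 0 by apply/resol_aug; exists l'.
  rewrite residue_khom -[l](subrK (resol 0 l')) Eu fcoordD fcoordZ residueD residueM.
  have /eqP -> : residue x == 0 by rewrite -kmaxE.
  by rewrite mul0r add0r => ->; rewrite residue0.
have /asboolP[s Es] : aug l \in kmax kx by rewrite kmaxE residue_khom E.
have /resol_aug[z Ez] : aug (l - x *: (kincl kx s *: fbasis R o)) = 0.
  rewrite augD -scaleNr !augZ aug_basis mulr1 gK Es.
  have -> : g (- x) = - gen_elt x by rewrite -(gK (- gen_elt x)).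
  by rewrite mulNr subrr.
exists (red z); rewrite resol_redE; apply/(reduction_eq (redP _)).
by exists (kincl kx s *: fbasis R o); rewrite -Ez opprB addrC subrK.
Qed.

(** The resolution of k is the reduction modulo x of the complex of R-modules
    [nat_complex resol_resol], which is therefore a lifting of it. *)
Lemma retraction_liftable :
  liftable_module (quot_map mx) (quot_residue_module mx).
Proof.
have rr i v : resol_red i (resol_red i.+1 v) = 0.
  by apply/resol_red_exact; exists v.
exists (nat_complex rr); split.
  split; first exact: nat_complex_free.
  - by case=> // m _ v; apply: fcoord_inj => -[].
  - case=> // m _ v /resol_red_exact[w Ew]; exists w; rewrite Ew.
    suff E : forall j (w' : freemod B (gens R)), j = m.+1 ->
        resol_red m.+1 w' = resol_red j w'.
      by apply: E; rewrite addn1.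
    by move=> j w' ->.
  - exists aug_red; split; first exact: aug_red_surj.
    by move=> v; rewrite aug_red_exact.
exists (nat_complex resol_resol); split; first exact: nat_complex_free.
exists (nat_complex rr); split; last first.
  exists (fun i => idfun : {linear _ -> _}); split=> [i|//].
  by exists id.
exists (fun i l b => b *: (freemod_red f l : freemod B _)).
split=> [i|i l b].
  exact: (reduction_base_change (quot_map_surj (mx := mx)) (quot_map_ker mx) (redP _)).
rewrite [LHS](linearZ_LR); congr (_ *: _).
case: i l => m l; first exact: resol_redE.
by rewrite [RHS]raddf0.
Qed.
End RetractionToLift.

(** * The equivalence *)

Theorem corollary4p6 (k : fieldType) (R : kalg k) (n : nat) (x : R)
    (mx : x \in kmax R) :
  noetherian R -> local_kalg R -> (0 < n)%N ->
  annihilator x =i principal (x ^+ n) ->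
  (exists r : R, r \in annihilator x /\ r <> 0) ->
  let kx := gen_ksubalg mx in
  let lift_k := liftable_module (quot_map mx) (quot_residue_module mx) in
  let retr := exists g : khom R kx, is_retraction (kincl kx) g in
  let semi := exists S : ksubalg R, semifiber_decomposition kx S in
  [/\ lift_k <-> retr,
      retr <-> semi,
      forall g : khom R kx, is_retraction (kincl kx) g ->
        exists S : ksubalg R,
          is_kernel_subalg g S /\ semifiber_decomposition kx S &
      forall S : ksubalg R, semifiber_decomposition kx S ->
        exists g : khom R kx,
          is_retraction (kincl kx) g /\ is_kernel_subalg g S].
Proof.
move=> _ _ _ annx _ kx lift_k retr semi.
have xn r : r * x = 0 <-> exists a, r = x ^+ n * a.
  have -> : (r * x = 0) <-> r \in annihilator x by split=> /eqP.
  by rewrite annx; split=> /asboolP.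
have ker_semi (g : khom R kx) : is_retraction (kincl kx) g ->
    exists S : ksubalg R, is_kernel_subalg g S /\ semifiber_decomposition kx S.
  move=> gr; exists (ker_ksubalg g); split; first exact: ker_kernel_subalg.
  exact: retraction_decomposition.
split=> //; last by move=> S; exact: decomposition_retraction.
  split; first exact: (@liftable_retraction _ _ _ n).
  by case=> g [_ _ gK]; exact: (@retraction_liftable _ _ _ n mx xn g).
split=> [[g /ker_semi[S [_ h]]]|[S /decomposition_retraction[g [h _]]]].
  by exists S.
by exists g.
Qed.
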